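(* The reproducing kernel Hilbert space $\mathcal{H}$ admits the orthogonal decomposition $$\mathcal{H} = \overline{\mathcal{H}} \oplus \mathcal{H}_\perp$$ where $\overline{\mathcal{H}} = \{f \in \mathcal{H} : f \text{ is } \mathcal{G}\text{-invariant}\}$ and $\mathcal{H}_\perp = \{f \in \mathcal{H} : \mathcal{O} f = 0\}$. Moreover, (with the inner product inherited from $\mathcal{H}$) $\overline{\mathcal{H}}$ is an RKHS with kernel $$\bar{k}(x,y) = \int_{\mathcal{G}} k(x, gy)\, d\lambda(g)$$ and $\mathcal{H}_\perp$ is an RKHS with kernel $$k^\perp(x,y) = k(x,y) - \bar{k}(x,y).$$ Finally, $\bar{k}$ is $\mathcal{G}$-invariant in both arguments.
   Context: Setting. $\mathcal{G}$ is a compact, second countable, Hausdorff topological group with Haar measure $\lambda$ normalised so that $\lambda(\mathcal{G}) = 1$. $\mathcal{X}$ is a non-empty Polish space on which $\mathcal{G}$ acts, the action being written $gx$, and the action is measurable: the map $\mathcal{G} \times \mathcal{X} \to \mathcal{X}$, $(g,x) \mapsto gx$, is $(\lambda\otimes\mu)$-measurable. $\mu$ is a Borel probability measure on $\mathcal{X}$ with $\operatorname{supp}\mu = \mathcal{X}$ that is $\mathcal{G}$-invariant, i.e. the pushforward of $\mu$ under $x \mapsto gx$ equals $\mu$ for every $g \in \mathcal{G}$. A function $f : \mathcal{X} \to \mathbb{R}$ is $\mathcal{G}$-invariant if $f(gx) = f(x)$ for all $x \in \mathcal{X}$, $g \in \mathcal{G}$. Kernel. $k : \mathcal{X} \times \mathcal{X}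 \to \mathbb{R}$ is a measurable (symmetric, positive-definite) kernel with RKHS $\mathcal{H}$, such that $k(\cdot, x)$ is continuous for every $x \in \mathcal{X}$, $\sup_{x \in \mathcal{X}} k(x,x) = M_k < \infty$, and for all $x, y \in \mathcal{X}$ $$\int_{\mathcal{G}} k(gx, y)\, d\lambda(g) = \int_{\mathcal{G}} k(x, gy)\, d\lambda(g).$$ Orbit averaging. For a measurable function $f : \mathcal{X} \to \mathbb{R}$, $\mathcal{O} f(x) = \int_{\mathcal{G}} f(gx)\, d\lambda(g)$. *)

(* Defs.v *)
From HB Require Import structures.
From mathcomp Require Import all_boot all_order all_algebra.
From mathcomp Require Import all_classical all_reals all_analysis.

Set Implicit Arguments.
Unset Strict Implicit.
Unset Printing Implicit Defensive.

Import Order.TTheory GRing.Theory Num.Theory.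
Import numFieldNormedType.Exports.

Local Open Scope classical_set_scope.
Local Open Scope ring_scope.

(* The base point is only there because g_sigma_algebraType asks for one; it is
   not required to be the unit. *)
HB.mixin Record isTopologicalGroup G & PointedTopological G & Group G := {
  mulg_continuous : continuous (fun p : G * G => (p.1 * p.2)%g) ;
  invg_continuous : continuous (fun x : G => (x^-1)%g)
}.

#[short(type="topologicalGroupType")]
HB.structure Definition TopologicalGroup :=
  {G of PointedTopological G & Group G & isTopologicalGroup G}.

Notation borel T := (g_sigma_algebraType (@open T)).

Section measurability.
Context {R : realType}.

(* Measurability of sets and functions with respect to the completion of m. *)
Definition null_measurable d (T : measurableType d) (m : set T -> \bar R)
    (A : set T) :=
  exists2 B, measurable B & m.-negligible ((A `\` B) `|` (B `\` A)).

Definition null_measurable_fun d d' (T : measurableType d)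
    (U : measurableType d') (m : set T -> \bar R) (f : T -> U) :=
  forall B, measurable B -> null_measurable m (f @^-1` B).

(* A Haar measure normalised to be a probability; regularity is not assumed (it
   is automatic on compact second countable Hausdorff groups). *)
Definition is_haar (G : topologicalGroupType)
    (lambda : probability (borel G) R) :=
  forall (g : G) (A : set (borel G)), measurable A ->
    lambda ((fun h : G => (g * h)%g) @` A) = lambda A.

Definition measure_support (X : ptopologicalType)
    (mu : {measure set (borel X) -> \bar R}) : set X :=
  [set x | forall U : set X, open U -> U x -> (0 < mu U)%E].

End measurability.

Section polish.
Context (R : realType) (X : topologicalType).

Definition complete_metrizable :=
  exists d : X -> X -> R,
    [/\ [/\ forall x y, 0 <= d x y,
            forall x y, d x y = 0 <-> x = y,
            forall x y, d x y = d y x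
          & forall x y z, d x z <= d x y + d y z],
        forall (x : X) (A : set X),
          nbhs x A <-> exists2 e : R, 0 < e & [set y | d x y < e] `<=` A
      & forall u : nat -> X,
          (forall e : R, 0 < e -> exists N, forall m n,
            (N <= m)%N -> (N <= n)%N -> d (u m) (u n) < e) ->
          exists x : X, u @ \oo --> x].

Definition polish :=
  (exists2 S : set X, countable S & dense S) /\ complete_metrizable.

End polish.

Definition is_action (G : groupType) (X : Type) (act : G -> X -> X) :=
  (forall x, act 1%g x = x) /\
  (forall g h x, act (g * h)%g x = act g (act h x)).

Definition G_invariant (G X Y : Type) (act : G -> X -> X) (f : X -> Y) :=
  forall g x, f (act g x) = f x.

(* The pushforward of mu under x |-> g x is mu for all g; x |-> g x need only be
   measurable for the completion of mu, on which the outer measure mu^* extends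
   mu. *)
Definition invariant_measure (R : realType) (G : Type) (X : ptopologicalType)
    (act : G -> X -> X) (mu : {measure set (borel X) -> \bar R}) :=
  forall g, null_measurable_fun mu (act g : borel X -> borel X) /\
    forall B : set (borel X), measurable B ->
      (mu^*)%mu (act g @^-1` B) = mu B.

Section rkhs.
Context (R : realType) (X : Type).
Implicit Types (H A B : set (X -> R)) (ip : (X -> R) -> (X -> R) -> R).

Definition positive_definite (k : X -> X -> R) :=
  forall n (x : 'I_n -> X) (c : 'I_n -> R),
    0 <= \sum_(i < n) \sum_(j < n) c i * c j * k (x i) (x j).

Definition hnorm ip (f : X -> R) := Num.sqrt (ip f f).

(* ip is a total function, but only its values on H x H are constrained; a
   subspace of H thus inherits the inner product by reusing ip. *)
Record hilbert_space H ip : Prop := {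
  hilbert0 : H (fun=> 0) ;
  hilbertP : forall (a : R) f g, H f -> H g -> H ((a \*o f) \+ g) ;
  ip_sym : forall f g, H f -> H g -> ip f g = ip g f ;
  ip_linear : forall (a : R) f g h, H f -> H g -> H h ->
    ip ((a \*o f) \+ g) h = a * ip f h + ip g h ;
  ip_ge0 : forall f, H f -> 0 <= ip f f ;
  ip_eq0 : forall f, H f -> ip f f = 0 -> f = (fun=> 0) ;
  hilbert_complete : forall u : nat -> X -> R, (forall n, H (u n)) ->
    (forall e : R, 0 < e -> exists N, forall m n, (N <= m)%N -> (N <= n)%N ->
      hnorm ip (u m \- u n) < e) ->
    exists2 f, H f & hnorm ip (u n \- f) @[n --> \oo] --> (0 : R)
}.

Record is_rkhs H ip (k : X -> X -> R) : Prop := {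
  rkhs_hilbert : hilbert_space H ip ;
  rkhs_kernel : forall x, H (k ^~ x) ;
  rkhs_reproducing : forall f x, H f -> f x = ip f (k ^~ x)
}.

Definition orthogonal_decomposition H ip A B :=
  [/\ H = [set f \+ g | f in A & g in B],
      A `&` B = [set fun=> 0]
    & forall f g, A f -> B g -> ip f g = 0].

End rkhs.

Section averaging.
Context (R : realType) (G : topologicalGroupType) (X : Type).
Context (lambda : probability (borel G) R) (act : G -> X -> X).
Implicit Types (f : X -> R) (k : X -> X -> R) (H : set (X -> R)).

Definition orbit_avg f (x : X) : R := \int[lambda]_g f (act g x).

(* The integrals exist and agree. As k is bounded, existence amounts to
   measurability of the integrands for the completion of lambda, which is
   automatic when each k(., y) is continuous and (g, x) |-> g x is Borel
   measurable. On such integrands, Borel or not, the integral below, a supremum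
   over simple functions, is the integral for the completion. *)
Definition averages_agree k :=
  forall x y,
    [/\ null_measurable_fun lambda (fun g : borel G => k (act g x) y),
        null_measurable_fun lambda (fun g : borel G => k x (act g y))
      & \int[lambda]_g k (act g x) y = \int[lambda]_g k x (act g y)].

Definition kernel_bar k (x y : X) : R := \int[lambda]_g k x (act g y).

Definition kernel_perp k (x y : X) : R := k x y - kernel_bar k x y.

Definition H_bar H : set (X -> R) := [set f | H f /\ G_invariant act f].

Definition H_perp H : set (X -> R) :=
  [set f | H f /\ orbit_avg f = (fun=> 0)].

End averaging.

(* Main.v *)
(* For f in H the functional f |-> O f(x) is bounded, hence by the Riesz theorem
   O f(x) = <f, r_x> for some r_x in H, and the reproducing property together with
   the exchange identity for k gives r_x = kbar(x, .).  A left Haar measure on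
   a compact group is also right invariant, so every kbar(x, .) is invariant.  Now
   project f on the closed subspace of invariant functions, f = p + q: as
   kbar(x, .) is invariant, O q(x) = <q, kbar(x, .)> = 0, and O p = p, so O is
   the orthogonal projection on the invariant functions and the other subspace
   is its kernel.
   Integrands are only measurable for the completed measure.  Each is Borel off
   a Borel null set, and the integral, a supremum over simple functions, does not
   see null sets even for non-measurable integrands. *)

Require Import Defs.
From mathcomp Require Import all_boot all_order all_algebra.
From mathcomp Require Import all_classical all_reals all_analysis.
From mathcomp Require Import measurable_realfun ring lra.
Import Order.TTheory GRing.Theory Num.Theory.
Import numFieldNormedType.Exports.
Local Open Scope classical_set_scope.
Local Open Scope ring_scope.

Set Implicit Arguments.
Unset Strict Implicit.
Unset Printing Implicit Defensive.

(** * Hilbert spaces of functions: projection and Riesz representation *)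

Section hilbert.
Context (R : realType) (X : Type) (H : set (X -> R)).
Context (ip : (X -> R) -> (X -> R) -> R).
Hypothesis HH : hilbert_space H ip.
Implicit Types (f g h : X -> R) (A S : set (X -> R)).

Lemma hilbertD f g : H f -> H g -> H (f \+ g).
Proof.
move=> Hf Hg; have := hilbertP HH 1 Hf Hg.
by congr H; apply/funext => x /=; rewrite mul1r.
Qed.

Lemma hilbertZ (a : R) f : H f -> H (a \*o f).
Proof.
move=> Hf; have := hilbertP HH a Hf (hilbert0 HH).
by congr H; apply/funext => x /=; rewrite addr0.
Qed.

Lemma hilbertB f g : H f -> H g -> H (f \- g).
Proof.
move=> Hf Hg; have := hilbertP HH (-1) Hg Hf.
by congr H; apply/funext => x /=; rewrite mulN1r addrC.
Qed.

Lemma ipDl f g h : H f -> H g -> H h -> ip (f \+ g) h = ip f h + ip g h.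
Proof.
move=> Hf Hg Hh; rewrite -[ip f h]mul1r -(ip_linear HH) //.
by congr ip; apply/funext => x /=; rewrite mul1r.
Qed.

Lemma ip0l h : H h -> ip (fun=> 0) h = 0.
Proof.
move=> Hh; have H0 := hilbert0 HH.
apply: (@addrI _ (ip (fun=> 0) h)); rewrite addr0 -ipDl //.
by congr ip; apply/funext => x /=; rewrite addr0.
Qed.

Lemma ipZl (a : R) f h : H f -> H h -> ip (a \*o f) h = a * ip f h.
Proof.
move=> Hf Hh; have H0 := hilbert0 HH.
rewrite -[RHS]addr0 -(ip0l Hh) -(ip_linear HH) //.
by congr ip; apply/funext => x /=; rewrite addr0.
Qed.

Lemma ipBl f g h : H f -> H g -> H h -> ip (f \- g) h = ip f h - ip g h.
Proof.
move=> Hf Hg Hh; rewrite -mulN1r -ipZl // addrC -ipDl //; last exact: hilbertZ.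
by congr ip; apply/funext => x /=; rewrite mulN1r addrC.
Qed.

Let ipC := ip_sym HH.

Lemma ipBr f g h : H f -> H g -> H h -> ip h (f \- g) = ip h f - ip h g.
Proof.
by move=> Hf Hg Hh; rewrite !(@ipC h) ?ipBl//; exact: hilbertB.
Qed.

Lemma ip_sqrB f g : H f -> H g ->
  ip (f \- g) (f \- g) = ip f f - 2 * ip f g + ip g g.
Proof.
move=> Hf Hg; have Hfg := hilbertB Hf Hg.
by rewrite ipBl // !ipBr // (ipC Hg Hf); ring.
Qed.

Lemma ip_sqrD f g : H f -> H g ->
  ip (f \+ g) (f \+ g) = ip f f + 2 * ip f g + ip g g.
Proof.
move=> Hf Hg; have Hfg := hilbertD Hf Hg.
by rewrite ipDl // (ipC Hf Hfg) (ipC Hg Hfg) !ipDl // (ipC Hg Hf); ring.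
Qed.

Lemma ip_sqrZ (a : R) f : H f -> ip (a \*o f) (a \*o f) = a ^+ 2 * ip f f.
Proof.
move=> Hf; have Haf := hilbertZ a Hf.
by rewrite ipZl // (ipC Hf Haf) ipZl // mulrA expr2.
Qed.

Lemma hnorm_ge0 f : 0 <= hnorm ip f.
Proof. exact: sqrtr_ge0. Qed.

Lemma hnorm_sqr f : H f -> hnorm ip f ^+ 2 = ip f f.
Proof. by move=> Hf; rewrite sqr_sqrtr // (ip_ge0 HH). Qed.

(** The residual of [f] after projection on the line through [g] has nonnegative squared norm; a [g]
    of norm zero is treated apart. *)
Lemma cauchy_schwarz f g : H f -> H g -> `|ip f g| <= hnorm ip f * hnorm ip g.
Proof.
move=> Hf Hg.
have [g0|g0] := eqVneq (ip g g) 0.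
  rewrite (ip_eq0 HH Hg g0) (ipC Hf (hilbert0 HH)) ip0l // normr0.
  by rewrite mulr_ge0 ?hnorm_ge0.
have gp : 0 < ip g g by rewrite lt_def g0 (ip_ge0 HH).
have Hag := hilbertZ (ip f g / ip g g) Hg.
have := ip_ge0 HH (hilbertB Hf Hag); rewrite ip_sqrB //.
rewrite (ipC Hf Hag) ip_sqrZ // ipZl // (ipC Hg Hf) => le0.
rewrite -ler_sqr ?nnegrE ?normr_ge0 ?mulr_ge0 ?hnorm_ge0 //.
rewrite exprMn !hnorm_sqr // real_normK ?num_real //.
rewrite -ler_pdivrMr // -subr_ge0; apply: le_trans le0 _.
by rewrite le_eqVlt; apply/orP; left; apply/eqP; field.
Qed.

Lemma cvg_hnorm_ip (u : nat -> X -> R) f h : (forall n, H (u n)) -> H f -> H h ->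
  hnorm ip (u n \- f) @[n --> \oo] --> (0 : R) ->
  ip (u n) h @[n --> \oo] --> ip f h.
Proof.
move=> Hu Hf Hh uf; apply/cvgrPdist_le => e e0.
(* The added 1 keeps the divisor positive when [h] has norm zero. *)
have d0 : 0 < e / (hnorm ip h + 1).
  by rewrite divr_gt0 // ltr_wpDl ?hnorm_ge0.
move/cvgrPdist_le : uf => /(_ _ d0); apply: filterS => n.
rewrite sub0r normrN ger0_norm ?hnorm_ge0 // => le_e.
rewrite distrC -ipBl //; apply: le_trans (cauchy_schwarz (hilbertB _ _) _) _ => //.
have h1 : 0 < hnorm ip h + 1 by rewrite ltr_wpDl ?hnorm_ge0.
move: le_e; rewrite ler_pdivlMr // => /(le_trans _); apply.
by rewrite ler_wpM2l ?hnorm_ge0 // lerDl.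
Qed.

(** A Cauchy sequence in [A] converges in [H], and closedness puts its limit back in [A]. *)
Lemma hilbert_closed_subspace A : A `<=` H -> A (fun=> 0) ->
  (forall (a : R) f g, A f -> A g -> A ((a \*o f) \+ g)) ->
  (forall (u : nat -> X -> R) f, (forall n, A (u n)) -> H f ->
    hnorm ip (u n \- f) @[n --> \oo] --> (0 : R) -> A f) ->
  hilbert_space A ip.
Proof.
move=> AH A0 AP Acl; split => //.
- by move=> f g /AH Hf /AH; exact: ipC.
- by move=> a f g h /AH Hf /AH Hg /AH; exact: (ip_linear HH).
- by move=> f /AH; exact: (ip_ge0 HH).
- by move=> f /AH; exact: (ip_eq0 HH).
- move=> u Au uC.
  have [f Hf uf] := hilbert_complete HH (fun n => AH _ (Au n)) uC.
  by exists f => //; exact: Acl uf.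
Qed.

(** Pairing with a fixed vector is norm continuous, so orthogonality survives limits. Both summands
    of the decomposition have this form. *)
Lemma hilbert_annihilator S : S `<=` H ->
  hilbert_space [set f | H f /\ forall s, S s -> ip f s = 0] ip.
Proof.
move=> SH; apply: hilbert_closed_subspace.
- by move=> f [].
- by split; [exact: (hilbert0 HH)|move=> s /SH; exact: ip0l].
- move=> a f g [Hf f0] [Hg g0]; split; first exact: (hilbertP HH).
  by move=> s Ss; rewrite (ip_linear HH) ?f0 ?g0 ?mulr0 ?addr0 //; exact: SH.
- move=> u f Au Hf uf; split => // s Ss.
  have Hu n : H (u n) by case: (Au n).
  have := cvg_hnorm_ip Hu Hf (SH _ Ss) uf.
  under eq_fun do rewrite (proj2 (Au _)) //.
  by move/(cvg_unique _ (cvg_cst (0 : R))) => ->.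
Qed.

(** A sequence minimising the distance from [f] to [A] is Cauchy; completeness of [A] gives a limit
    [p], and minimality makes [f \- p] orthogonal to [A]. *)
Lemma hilbert_projection A : A `<=` H -> hilbert_space A ip ->
  forall f, H f -> exists2 p, A p & forall a, A a -> ip (f \- p) a = 0.
Proof.
move=> AH HA f Hf.
pose D := [set ip (f \- a) (f \- a) | a in A].
have D0 : has_inf D.
  split.
    exists (ip (f \- fun=> 0) (f \- fun=> 0)), (fun=> 0) => //.
    exact: (hilbert0 HA).
  by exists 0 => _ [a /AH Ha <-]; apply: (ip_ge0 HH); exact: hilbertB.
have infD a : A a -> inf D <= ip (f \- a) (f \- a).
  by move=> Aa; apply: ge_inf; [exact: D0.2|exists a].
pose ep (n : nat) : R := n.+1%:R^-1.
have ep0 n : 0 < ep n by rewrite invr_gt0.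
have /choice[u uP] n : exists a, A a /\ ip (f \- a) (f \- a) < inf D + ep n.
  by have [_ [a Aa <-] ?] := inf_adherent (ep0 n) D0; exists a.
have Au n : A (u n) by case: (uP n).
have Hu n : H (u n) by exact/AH/Au.
have Hfu n : H (f \- u n) by exact: hilbertB.
(* Parallelogram law: a minimising sequence is Cauchy. *)
have uC m n : ip (u m \- u n) (u m \- u n) <= 2 * ep m + 2 * ep n.
  have Am : A (2^-1 \*o (u m \+ u n)).
    have := hilbertP HA 1 (Au m) (Au n).
    move/(hilbertP HA 2^-1)/(_ (hilbert0 HA)).
    by congr A; apply/funext => x /=; rewrite mul1r addr0.
  have := infD _ Am.
  have -> : f \- (2^-1 \*o (u m \+ u n)) =
      2^-1 \*o ((f \- u m) \+ (f \- u n)).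
    by apply/funext => x /=; field.
  have -> : u m \- u n = (f \- u n) \- (f \- u m).
    by apply/funext => x /=; ring.
  have Hs := hilbertD (Hfu m) (Hfu n).
  rewrite ip_sqrB // ip_sqrZ // ip_sqrD // (ipC (Hfu n) (Hfu m)).
  have := (uP m).2; have := (uP n).2; lra.
have [||p Ap up] := @hilbert_complete _ _ _ _ HA u => //.
  move=> e e0; have e20 : 0 < e ^+ 2 / 4 by rewrite divr_gt0 ?exprn_gt0.
  (* From this rank on [ep] is below [e ^+ 2 / 4], so [uC] keeps squared distances below
     [e ^+ 2]. *)
  exists (Num.truncn (e ^+ 2 / 4)^-1) => m n mN nN.
  have epN k : (Num.truncn (e ^+ 2 / 4)^-1 <= k)%N -> ep k < e ^+ 2 / 4.
    move=> kN; rewrite /ep invf_plt ?posrE //.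
    apply: lt_le_trans (truncnS_gt _) _.
    by rewrite ler_nat ltnS.
  rewrite -ltr_sqr ?nnegrE ?hnorm_ge0 ?ltW // hnorm_sqr; last exact: hilbertB.
  apply: le_lt_trans (uC m n) _.
  have := epN _ mN; have := epN _ nN; lra.
exists p => // a Aa.
have [Hp Ha] := (AH _ Ap, AH _ Aa).
(* Minimality tested along the line u n + t a, at the optimal t. *)
have var n : ip (f \- u n) a ^+ 2 <= ip a a * ep n.
  have [a0|a0] := eqVneq (ip a a) 0.
    rewrite (ip_eq0 HH Ha a0) (ipC (Hfu n) (hilbert0 HH)) ip0l // expr0n /=.
    by rewrite ip0l ?mul0r //; exact: (hilbert0 HH).
  have ap : 0 < ip a a by rewrite lt_def a0 (ip_ge0 HH).
  pose t := ip (f \- u n) a / ip a a.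
  have := infD _ (hilbertP HA t Aa (Au n)).
  have -> : f \- ((t \*o a) \+ u n) = (f \- u n) \- (t \*o a).
    by apply/funext => x /=; ring.
  have Hta := hilbertZ t Ha.
  rewrite ip_sqrB // ip_sqrZ // (ipC (Hfu n) Hta) ipZl //.
  rewrite (ipC Ha (Hfu n)) => le1; rewrite mulrC -ler_pdivrMr //.
  have -> : ip (f \- u n) a ^+ 2 / ip a a =
     2 * (t * ip (f \- u n) a) - t ^+ 2 * ip a a by rewrite /t; field.
  have := (uP n).2; lra.
(* In the limit [var] bounds the square of [ip (f \- p) a] by zero. *)
have c1 : ip (f \- u n) a ^+ 2 @[n --> \oo] --> ip (f \- p) a ^+ 2.
  under eq_fun do rewrite ipBl // expr2.
  rewrite ipBl // expr2.
  by apply: cvgM; apply: cvgB; try exact: cvg_cst; exact: cvg_hnorm_ip.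
have c2 : ip a a * ep n @[n --> \oo] --> ip a a * 0.
  by apply: cvgM; [exact: cvg_cst|exact: cvg_harmonic].
apply/eqP; rewrite -sqrf_eq0 eq_le sqr_ge0 andbT -(mulr0 (ip a a)).
rewrite -(cvg_lim _ c1) // -(cvg_lim _ c2) //.
apply: ler_lim; [exact: cvgP c1|exact: cvgP c2|exact: nearW].
Qed.

(** The residual of the projection on [A] is orthogonal to [A], hence zero. This extends a property
    from kernel sections to all of [H]. *)
Lemma hilbert_dense A : A `<=` H -> hilbert_space A ip ->
  (forall f, H f -> (forall a, A a -> ip f a = 0) -> f = fun=> 0) -> A = H.
Proof.
move=> AH HA A0; apply/seteqP; split => // f Hf.
have [p Ap fp0] := hilbert_projection AH HA Hf.
have /funeqP fp := A0 _ (hilbertB Hf (AH _ Ap)) fp0.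
suff -> : f = p by [].
by apply/funext => x; apply/subr0_eq/fp.
Qed.

(** Boundedness makes the kernel [K] of [L] closed. If [L] is nonzero, a vector [q] outside [K] and
    orthogonal to it represents [L] after scaling. *)
Lemma riesz (L : (X -> R) -> R) (C : R) :
  (forall (a : R) f g, H f -> H g -> L ((a \*o f) \+ g) = a * L f + L g) ->
  (forall f, H f -> `|L f| <= C * hnorm ip f) ->
  exists2 r, H r & forall f, H f -> L f = ip f r.
Proof.
move=> LP LC.
have H0 := hilbert0 HH.
have L0 : L (fun=> 0) = 0.
  apply/eqP; rewrite -normr_le0; apply: le_trans (LC _ H0) _.
  by rewrite /hnorm ip0l // sqrtr0 mulr0.
have LB f g : H f -> H g -> L (f \- g) = L f - L g.
  move=> Hf Hg; rewrite addrC -mulN1r -LP //.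
  by congr L; apply/funext => x /=; rewrite mulN1r addrC.
pose K := [set f | H f /\ L f = 0].
have KH : K `<=` H by move=> f [].
have HK : hilbert_space K ip.
  apply: hilbert_closed_subspace => //.
  - move=> a f g [Hf f0] [Hg g0]; split; first exact: (hilbertP HH).
    by rewrite LP // f0 g0 mulr0 addr0.
  - move=> u f Ku Hf uf; split => //; apply/eqP; rewrite -normr_le0.
    have c : C * hnorm ip (u n \- f) @[n --> \oo] --> C * 0.
      by apply: cvgM => //; exact: cvg_cst.
    rewrite -(mulr0 C) -(cvg_lim _ c) //.
    apply: limr_ge; first exact: cvgP c.
    apply: nearW => n; have [Hu Lu] := Ku n.
    by apply: le_trans (LC _ (hilbertB Hu Hf)); rewrite LB // Lu sub0r normrN.
have [LK|/existsNP[f0 /not_implyP[Hf0 Lf0]]] :=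
  pselect (forall f, H f -> L f = 0).
  by exists (fun=> 0) => // f Hf; rewrite LK // ipC // ip0l.
have [p Kp pP] := hilbert_projection KH HK Hf0.
have [Hp Lp] := Kp; set q := f0 \- p in pP.
have Hq : H q by exact: hilbertB.
have Lq : L q != 0 by rewrite LB // Lp subr0; exact/eqP.
have qq : ip q q != 0.
  by apply: contra_neq Lq => /(ip_eq0 HH Hq) ->.
exists ((L q / ip q q) \*o q); first exact: hilbertZ.
move=> f Hf; have Hcq := hilbertZ (L q / ip q q) Hq.
(* Removing this multiple of [q] lands in [K], so pairing with [q] determines [L f]. *)
have KK : K (f \- ((L f / L q) \*o q)).
  split; first by apply: hilbertB => //; exact: hilbertZ.
  rewrite LB //; last exact: hilbertZ.
  have -> : (L f / L q) \*o q = ((L f / L q) \*o q) \+ (fun=> 0).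
    by apply/funext => x /=; rewrite addr0.
  by rewrite LP // L0 addr0 divfK // subrr.
have Hfq := hilbertZ (L f / L q) Hq.
have := pP _ KK; rewrite ipBr // (ipC Hq Hfq) ipZl // (ipC Hq Hf) => e.
rewrite (ipC Hf Hcq) ipZl // (ipC Hq Hf) (subr0_eq e).
by field; rewrite Lq.
Qed.

End hilbert.

(** * Measurability and integration modulo null sets *)

Section null_measurable.
Context d (T : measurableType d) (R : realType).
Variable mu : {measure set T -> \bar R}.
Implicit Types f g : T -> R.

(** Preimages of rays with rational endpoints differ from measurable sets by negligible sets. There
    are countably many, so a single null [N] covers all the differences, and such rays suffice to
    test measurability. *)
Lemma null_measurable_funP f : null_measurable_fun mu f <->
  exists N, [/\ measurable N, mu N = 0%E & measurable_fun (~` N) f].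
Proof.
split=> [nf|[N [mN N0 mf]] B mB]; last first.
  exists (~` N `&` f @^-1` B); first exact: mf (measurableC mN) _ mB.
  by exists N; split => // x [[/= Bx /not_andP[/contrapT//|//]]|[[/= ? ?] []]].
have /choice[B BP] : forall q : rat, exists B, measurable B /\
    mu.-negligible ((f @^-1` `]ratr q, +oo[ `\` B) `|`
                    (B `\` f @^-1` `]ratr q, +oo[)).
  by move=> q; have [B] := nf `]ratr q, +oo[%classic (measurable_itv _); exists B.
(* An enumeration of the rationals; the default 0 is harmless, as only surjectivity matters. *)
pose e n : rat := odflt 0 (unpickle n).
have [N [mN N0 eN]] : mu.-negligible (\bigcup_n
    ((f @^-1` `]ratr (e n), +oo[ `\` B (e n)) `|`
     (B (e n) `\` f @^-1` `]ratr (e n), +oo[))).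
  by apply: negligible_bigcup => n; exact: (BP _).2.
exists N; split => //.
have BN (q : rat) x : ~ N x -> B q x <-> ratr q < f x.
  move=> Nx; have eq : e (pickle q) = q by rewrite /e pickleK.
  have {}Nx := contra_not (eN x) Nx.
  split=> [Bx|fx]; apply: contrapT => H; apply: Nx; exists (pickle q) => //;
    rewrite eq; [right|left]; split => //=; rewrite in_itv /= andbT //.
apply: (measurability _ (RGenOInfty.measurableE R)).
move=> _ [_ [r ->] <-].
rewrite (_ : _ `&` _ = \bigcup_(q : rat)
    (if r < ratr q then ~` N `&` B q else set0)).
  apply: bigcupT_measurable_rat => q; case: ifP => // _.
  by apply: measurableI; [exact: measurableC|exact: (BP q).1].
apply/seteqP; split => x.
  move=> [Nx /=]; rewrite in_itv /= andbT => /rat_in_itvoo[q].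
  rewrite in_itv /= => /andP[rq qf].
  by exists q => //; rewrite rq; split => //; exact/BN.
move=> [q _]; case: ifP => // rq [Nx /BN fx]; split => //=.
by rewrite in_itv /= andbT (lt_trans rq) // fx.
Qed.

Lemma null_measurable_funP2 f g :
  null_measurable_fun mu f -> null_measurable_fun mu g ->
  exists N, [/\ measurable N, mu N = 0%E,
    measurable_fun (~` N) f & measurable_fun (~` N) g].
Proof.
move=> /null_measurable_funP[N [mN N0 mf]] /null_measurable_funP[M [mM M0 mg]].
exists (N `|` M); split; first exact: measurableU.
- apply: measure_negligible; first exact: measurableU.
  by apply: negligibleU; exact/negligibleP.
- by apply: measurable_funS mf; [exact: measurableC|rewrite setCU => x []].
- by apply: measurable_funS mg; [exact: measurableC|rewrite setCU => x []].
Qed.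

Lemma null_measurable_fun_linear (a : R) f g :
  null_measurable_fun mu f -> null_measurable_fun mu g ->
  null_measurable_fun mu ((a \*o f) \+ g).
Proof.
move=> nf ng; have [N [mN N0 mf mg]] := null_measurable_funP2 nf ng.
apply/null_measurable_funP; exists N; split => //.
by apply: measurable_funD => //; apply: measurable_funM.
Qed.

Lemma null_measurable_fun_cst (c : R) : null_measurable_fun mu (fun=> c).
Proof.
by apply/null_measurable_funP; exists set0; split => //; exact: measurable_cst.
Qed.

Lemma null_measurable_fun_cvg (u : nat -> T -> R) f :
  (forall n, null_measurable_fun mu (u n)) ->
  (forall x, u n x @[n --> \oo] --> f x) -> null_measurable_fun mu f.
Proof.
move=> nu uf.
have /choice[N NP] : forall n, exists N, [/\ measurable N, mu N = 0%E &
    measurable_fun (~` N) (u n)] by move=> n; exact/null_measurable_funP.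
have mN : measurable (\bigcup_n N n).
  by apply: bigcupT_measurable => n; case: (NP n).
apply/null_measurable_funP; exists (\bigcup_n N n); split => //.
  apply: measure_negligible => //; apply: negligible_bigcup => n.
  by apply/negligibleP; case: (NP n).
apply: (measurable_fun_cvg (h := u)) => [n|x _]; last exact: uf.
have [mNn _ mu_n] := NP n; apply: measurable_funS mu_n; first exact: measurableC.
by apply: subsetC; exact: bigcup_sup.
Qed.

Import HBNNSimple.

(** For nonnegative [f], measurable or not, cutting a simple function below [f] to zero on [N] keeps
    its integral, so both suprema agree. *)
Lemma integral_setC_null (N : set T) (f : T -> \bar R) : measurable N ->
  mu N = 0%E -> (\int[mu]_x f x = \int[mu]_(x in ~` N) f x)%E.
Proof.
move=> mN N0; have mCN := measurableC mN.
wlog f0 : f / forall x, (0 <= f x)%E.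
  by move=> H; rewrite integralE [RHS]integralE; congr (_ - _)%E; exact: H.
rewrite ge0_integralTE // ge0_integralE //.
apply/eqP; rewrite eq_le; apply/andP; split; last first.
  apply: le_ereal_sup => _ [h hf <-]; exists h => // x.
  by apply: le_trans (hf x) _; rewrite patchE; case: ifP.
apply: ge_ereal_sup => _ [h hf <-]; apply: ereal_sup_ubound.
exists (proj_nnsfun h mCN); first move=> x.
  by rewrite -mrestrict !patchE; case: ifP => // _; exact: hf.
rewrite -mrestrict -integral_nnsfun // -setTD -ge0_negligible_integral //.
- by rewrite integral_nnsfun // patch_setT.
- exact/measurable_EFinP/measurable_funPT.
- by move=> x _; rewrite lee_fin.
Qed.

End null_measurable.

(** * Averages of bounded functions against a probability *)

Section probability_average.
Context d (T : measurableType d) (R : realType) (P : probability T R).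
Implicit Types f g : T -> R.

Lemma bounded_integrable (D : set T) (C : R) f : measurable D ->
  measurable_fun D f -> (forall x, `|f x| <= C) -> P.-integrable D (EFin \o f).
Proof.
move=> mD mf fC; apply: measurable_bounded_integrable => //.
  by rewrite (le_lt_trans (probability_le1 _ _)) // ltry.
exists C; split; first exact: num_real.
by move=> M CM x _; apply: le_trans (fC x) (ltW CM).
Qed.

(** Off a common null set both functions are measurable and bounded, hence integrable. *)
Lemma Rintegral_null_measurable_linear (a C D : R) f g :
  null_measurable_fun P f -> null_measurable_fun P g ->
  (forall x, `|f x| <= C) -> (forall x, `|g x| <= D) ->
  \int[P]_x (a * f x + g x) = a * \int[P]_x f x + \int[P]_x g x.
Proof.
move=> nf ng fC gD; have [N [mN N0 mf mg]] := null_measurable_funP2 nf ng.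
have mCN := measurableC mN.
have E h : \int[P]_x h x = \int[P]_(x in ~` N) h x.
  by rewrite /Rintegral (integral_setC_null _ mN N0).
have fi := bounded_integrable mCN mf fC.
rewrite !E RintegralD ?RintegralZl //; last exact: bounded_integrable gD.
apply: (@bounded_integrable _ (`|a| * C)) => //.
  by apply: measurable_funM => //; exact: measurable_cst.
by move=> x; rewrite normrM ler_wpM2l.
Qed.

Lemma normr_Rintegral_le (C : R) f : null_measurable_fun P f ->
  (forall x, `|f x| <= C) -> `|\int[P]_x f x| <= C.
Proof.
move=> /null_measurable_funP[N [mN N0 mf]] fC; have mCN := measurableC mN.
rewrite /Rintegral (integral_setC_null _ mN N0).
have fi := bounded_integrable mCN mf fC.
apply: le_trans (le_normr_Rintegral mCN fi) _.
(* The bound at the base point forces [C] to be nonnegative. *)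
have C0 : 0 <= C by exact: le_trans (normr_ge0 _) (fC point).
apply: (@le_trans _ _ (\int[P]_(x in ~` N) C)); last first.
  rewrite Rintegral_cst // ler_piMr // -lee_fin fineK ?probability_le1 //.
  exact: fin_num_measure.
apply: le_Rintegral => //.
- exact: integrable_norm.
- by apply: (@bounded_integrable _ `|C|) => //; exact: measurable_cst.
Qed.

End probability_average.

(** * Haar measure: inversion and right translation *)

Section topological_group.
Variables (R : realType) (G : topologicalGroupType).

Lemma second_countable_sequence (U : ptopologicalType) :
  @second_countable U -> exists e : nat -> set U, (forall n, open (e n)) /\
    forall x A, nbhs x A -> exists n, e n x /\ e n `<=` A.
Proof.
move=> [B cB [Bo Bb]].
have ex x A : nbhs x A -> exists2 V, B V & V x /\ V `<=` A.
  by move=> /Bb[V /= [BV Vx] VA]; exists V.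
(* An empty base is impossible, since it would not cover [point]. *)
have [B0|[e]] := pfcard_geP cB.
  by have [V] := ex point setT filterT; rewrite B0.
exists e; split=> [n|x A /ex[V BV [Vx VA]]]; first exact/Bo/funS.
by have [n _ eV] := 'surj_e BV; exists n; rewrite eV.
Qed.

(** An open set is the union of the countably many basic rectangles inside it. Continuous maps on
    [G * G] thereby become measurable for the product sigma-algebra, as Fubini requires. *)
Lemma open_measurableX (U V : ptopologicalType) (W : set (U * V)) :
  @second_countable U -> @second_countable V -> open W ->
  measurable (W : set (borel U * borel V)).
Proof.
move=> /second_countable_sequence[a [ao ab]].
move=> /second_countable_sequence[b [bo bb]] oW.
rewrite (_ : W = \bigcup_n \bigcup_m
    (if `[< a n `*` b m `<=` W >] then a n `*` b m else set0)).
  apply: bigcupT_measurable => n; apply: bigcupT_measurable => m.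
  case: ifP => // _.
  apply: (@measurableX _ _ (borel U) (borel V)); apply: sub_sigma_algebra.
    exact: ao.
  exact: bo.
apply/seteqP; split => [[x y] Wxy|[x y] [n _ [m _]]]; last first.
  by case: ifP => // /asboolP; apply.
have [[A C] /= [Ax Cy] ACW] := open_nbhs_nbhs (conj oW Wxy).
have [n [anx anA]] := ab _ _ Ax; have [m [bmy bmC]] := bb _ _ Cy.
exists n => //; exists m => //; rewrite ifT //.
by apply/asboolP => -[u v] [/= /anA Au /bmC Cv]; exact: ACW.
Qed.

Hypothesis G2 : @second_countable G.

Lemma continuous_divg : continuous (fun p : G * G => (p.1^-1 * p.2)%g).
Proof.
move=> p; apply: (@continuous2_cvg _ _ _ _ _ _ _ _ (fun x y : G => (x * y)%g)).
- exact: (@mulg_continuous G (_, _)).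
- apply: continuous_comp; [exact: cvg_fst|exact: invg_continuous].
- exact: cvg_snd.
Qed.

Lemma continuous_mulgr (h : G) : continuous (fun g : G => (g * h)%g).
Proof.
move=> g; apply: (@continuous2_cvg _ _ _ _ _ _ _ _ (fun x y : G => (x * y)%g)).
- exact: (@mulg_continuous G (_, _)).
- exact: cvg_id.
- exact: cvg_cst.
Qed.

Lemma measurable_fun_borel (U V : ptopologicalType) (f : U -> V) :
  continuous f -> measurable_fun [set: borel U] (f : borel U -> borel V).
Proof.
move=> /continuousP cf.
apply: (measurability _ (erefl : @measurable _ (borel V) = <<s @open V >>)).
by move=> _ [W oW <-]; rewrite setTI; apply: sub_sigma_algebra; exact: cf.
Qed.

Lemma measurable_fun_divg :
  measurable_fun [set: borel G * borel G]
    (fun p : borel G * borel G => (p.1^-1 * p.2)%g : borel G).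
Proof.
apply: (measurability _ (erefl : @measurable _ (borel G) = <<s @open G >>)).
move=> _ [W oW <-]; rewrite setTI; apply: open_measurableX => //.
by move/continuousP : continuous_divg; apply.
Qed.

Variable lambda : probability (borel G) R.
Hypothesis lambda_haar : is_haar lambda.

(** [is_haar] speaks of images; a preimage under left translation by [g] is an image under
    translation by [g^-1]. *)
Lemma haar_mulgl (g : G) (A : set (borel G)) : measurable A ->
  lambda [set h : G | A (g * h)%g] = lambda A.
Proof.
move=> mA; rewrite -(lambda_haar g^-1%g mA); congr (lambda _).
apply/seteqP; split => [h /= Ah|_ [h Ah <-] /=]; last by rewrite mulVKg.
by exists (g * h)%g => //; rewrite mulKg.
Qed.

(* Fubini for the set of (g, h) with g^-1 h in A: by left invariance its sections
   along g have measure lambda A and those along h measure lambda A^-1. *)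
Lemma haar_invg (A : set (borel G)) : measurable A ->
  lambda [set g : G | A (g^-1)%g] = lambda A.
Proof.
move=> mA.
pose S := [set p : borel G * borel G | A (p.1^-1 * p.2)%g].
have mS : measurable S by rewrite -[S]setTI; exact: measurable_fun_divg.
have mI : measurable ([set g | A (g^-1)%g] : set (borel G)).
  have := measurable_fun_borel (@invg_continuous G) measurableT mA.
  by rewrite setTI.
have <- : ((lambda \x lambda) S = lambda A)%E.
  transitivity (\int[lambda]_g lambda A)%E.
    apply: eq_integral => g _ /=; rewrite -(haar_mulgl (g : G)^-1%g mA).
    by congr (lambda _); apply/seteqP; split=> h; rewrite /xsection /= inE.
  by rewrite integral_cst // -[RHS]mule1 -(probability_setT lambda).
have <- : ((lambda \x^ lambda) S = lambda [set g | A (g^-1)%g])%E.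
  transitivity (\int[lambda]_h lambda [set g | A (g^-1)%g])%E.
    apply: eq_integral => h _ /=; rewrite -(haar_mulgl (h : G)^-1%g mI).
    congr (lambda _); apply/seteqP.
    by split => g; rewrite /ysection /= inE /S /= invgM invgK.
  by rewrite integral_cst // -[RHS]mule1 -(probability_setT lambda).
(* The two orders of integration agree on rectangles, hence on [S]. *)
apply/esym/(product_measure_unique (m' := (lambda \x^ lambda)%E)) => //.
by move=> B C mB mC; exact: product_measure2E.
Qed.

(** Right translation by [h] is left translation by [h^-1] conjugated by inversion, and both
    preserve [lambda]. *)
Lemma haar_mulgr (h : G) (A : set (borel G)) : measurable A ->
  lambda [set g : G | A (g * h)%g] = lambda A.
Proof.
move=> mA.
have mI : measurable ([set g | A (g^-1)%g] : set (borel G)).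
  have := measurable_fun_borel (@invg_continuous G) measurableT mA.
  by rewrite setTI.
have mR : measurable ([set g : G | A (g * h)%g] : set (borel G)).
  have := measurable_fun_borel (@continuous_mulgr h) measurableT mA.
  by rewrite setTI.
rewrite -(haar_invg mR) -(haar_invg mA) -(haar_mulgl (h : G)^-1%g mI); congr (lambda _).
by apply/seteqP; split => g /=; rewrite invgM invgK.
Qed.

(** The preimage of [N] under the translation is null too, so variables can be changed on the
    complements, where everything is Borel. *)
Lemma Rintegral_mulgr (h : G) (f : G -> R) :
  null_measurable_fun lambda (f : borel G -> R) ->
  \int[lambda]_(g in [set: borel G]) f (g * h)%g = \int[lambda]_g f g.
Proof.
move=> /null_measurable_funP[N [mN N0 mf]]; have mCN := measurableC mN.
pose r : borel G -> borel G := fun g => (g * h)%g.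
have mr : measurable_fun [set: borel G] r.
  exact: measurable_fun_borel (@continuous_mulgr h).
have mrN : measurable (r @^-1` N) by rewrite -[_ @^-1` _]setTI; exact: mr.
have rN0 : lambda (r @^-1` N) = 0%E by exact: etrans (haar_mulgr h mN) N0.
(* Nonnegativity suits the positive and negative parts of [f], treated separately below. *)
have key (F : borel G -> \bar R) : measurable_fun (~` N) F ->
    (forall g, 0 <= F g)%E ->
    (\int[lambda]_(g in r @^-1` (~` N)) F (r g) = \int[lambda]_(g in ~` N) F g)%E.
  move=> mF F0.
  rewrite -(ge0_integral_pushforward mr lambda mCN mF); last by move=> g _.
  by apply: eq_measure_integral => A mA _; rewrite /pushforward; exact: haar_mulgr.
rewrite /Rintegral (integral_setC_null _ mrN rN0) (integral_setC_null _ mN N0).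
congr fine; rewrite preimage_setC integralE [RHS]integralE; congr (_ - _)%E.
  apply: etrans (key (EFin \o f)^\+%E _ _) => //.
    by apply: eq_integral => x _; rewrite unlock.
  by apply: measurable_funepos; exact/measurable_EFinP.
apply: etrans (key (EFin \o f)^\-%E _ _) => //.
  by apply: eq_integral => x _; rewrite unlock.
by apply: measurable_funeneg; exact/measurable_EFinP.
Qed.

End topological_group.

(** * Point evaluation in an RKHS *)

Section rkhs_theory.
Context (R : realType) (X : Type) (H : set (X -> R)).
Context (ip : (X -> R) -> (X -> R) -> R) (k : X -> X -> R).
Hypothesis Hk : is_rkhs H ip k.
Let HH := rkhs_hilbert Hk.

(** Cauchy-Schwarz against the kernel section at [x], whose squared norm is [k x x]. *)
Lemma rkhs_norm_le f x : H f -> `|f x| <= Num.sqrt (k x x) * hnorm ip f.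
Proof.
move=> Hf; have Hkx := rkhs_kernel Hk x.
rewrite (rkhs_reproducing Hk x Hf) mulrC (rkhs_reproducing Hk x Hkx).
exact: cauchy_schwarz HH _ _ _ _.
Qed.

Lemma rkhs_cvg (u : nat -> X -> R) f x : (forall n, H (u n)) -> H f ->
  hnorm ip (u n \- f) @[n --> \oo] --> (0 : R) -> u n x @[n --> \oo] --> f x.
Proof.
move=> Hu Hf uf; rewrite (rkhs_reproducing Hk x Hf).
under eq_fun do rewrite (rkhs_reproducing Hk x (Hu _)).
exact: cvg_hnorm_ip HH _ _ _ Hu Hf (rkhs_kernel Hk x) uf.
Qed.

End rkhs_theory.

(** * Orbit averaging on the RKHS and the two summands *)

Section orbit_averaging.
Context (R : realType) (G : topologicalGroupType) (X : Type).
Context (lambda : probability (borel G) R) (act : G -> X -> X).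
Context (k : X -> X -> R) (H : set (X -> R)).
Context (ip : (X -> R) -> (X -> R) -> R).
Hypothesis k_symmetric : forall x y, k x y = k y x.
Hypothesis k_averages_agree : averages_agree lambda act k.
Hypothesis Hk : is_rkhs H ip k.
Let HH := rkhs_hilbert Hk.
Local Notation avg := (orbit_avg lambda act).
Local Notation kbar := (kernel_bar lambda act k).

(* The functions with this property form a closed subspace of H containing every
   k(., y), hence all of H. *)
Lemma null_measurable_orbit f x : H f ->
  null_measurable_fun lambda (fun g : borel G => f (act g x)).
Proof.
move=> Hf.
pose K := [set f | H f /\ forall x,
  null_measurable_fun lambda (fun g : borel G => f (act g x))].
suff KE : K = H by move: Hf; rewrite -{1}KE => -[].
apply: (hilbert_dense HH); first by move=> f' [].
  apply: (hilbert_closed_subspace HH).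
  - by move=> f' [].
  - split; first exact: (hilbert0 HH).
    by move=> y; exact: null_measurable_fun_cst.
  - move=> a f1 f2 [Hf1 nf1] [Hf2 nf2]; split; first exact: (hilbertP HH).
    by move=> y; exact: null_measurable_fun_linear (nf1 y) (nf2 y).
  - move=> u f' Ku Hf' uf; split => // y.
    apply: (@null_measurable_fun_cvg _ (borel G) _ lambda
      (fun n (g : borel G) => u n (act g y))).
      by move=> n; exact: (Ku n).2.
    by move=> g; apply: (rkhs_cvg Hk) => // n; exact: (Ku n).1.
move=> f' Hf' f'0; apply/funext => y.
rewrite (rkhs_reproducing Hk y Hf'); apply: f'0; split.
  exact: rkhs_kernel Hk y.
by move=> z; have [] := k_averages_agree z y.
Qed.

(** The exchange identity moves the group element to the other argument; symmetry of [k] then swaps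
    the two. *)
Lemma kernel_bar_sym x y : kbar x y = kbar y x.
Proof.
rewrite /kernel_bar; have [_ _ <-] := k_averages_agree y x.
by apply: eq_Rintegral => g _; exact: k_symmetric.
Qed.

Lemma orbit_avg_invariant f : G_invariant act f -> avg f = f.
Proof.
move=> f_inv; apply/funext => x; rewrite /orbit_avg.
under eq_Rintegral do rewrite f_inv.
rewrite Rintegral_cst //; have := probability_setT lambda.
by move=> /= ->; rewrite mulr1.
Qed.

Section bounded.
Variable M : R.
Hypothesis k_le : forall x, k x x <= M.

Lemma rkhs_bounded f x : H f -> `|f x| <= Num.sqrt M * hnorm ip f.
Proof.
move=> Hf; apply: le_trans (rkhs_norm_le Hk x Hf) _.
by rewrite ler_wpM2r ?hnorm_ge0 // ler_wsqrtr.
Qed.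

(* By the Riesz theorem orbit averaging at x is represented by some r in H, and
   r y = ip r k_y = avg k_y x = kbar x y. *)
Lemma orbit_avgE x :
  H (kbar x) /\ forall f, H f -> avg f x = ip f (kbar x).
Proof.
have [a f g Hf Hg|f Hf|r Hr rP] := riesz HH (L := avg ^~ x) (C := Num.sqrt M).
- apply: Rintegral_null_measurable_linear.
  + exact: null_measurable_orbit.
  + exact: null_measurable_orbit.
  + by move=> h; exact: rkhs_bounded.
  + by move=> h; exact: rkhs_bounded.
- apply: normr_Rintegral_le; first exact: null_measurable_orbit.
  by move=> g; exact: rkhs_bounded.
suff -> : kbar x = r by [].
apply/funext => y; have Hky := rkhs_kernel Hk y.
rewrite (rkhs_reproducing Hk y Hr) (ip_sym HH Hr Hky) -rP //.
by have [_ _] := k_averages_agree x y.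
Qed.

(** Discharged in the theorem from the right invariance of [lambda]. *)
Hypothesis kbar_inv : forall x, G_invariant act (kbar x).

Let Hbar_kbar x : H_bar act H (kbar x).
Proof. by split; [exact: (orbit_avgE x).1|exact: kbar_inv]. Qed.

Let Hbar_sub : H_bar act H `<=` H. Proof. by move=> f []. Qed.

Let kbarl x : kbar ^~ x = kbar x.
Proof. by apply/funext => y; exact: kernel_bar_sym. Qed.

(** By the reproducing property, invariance is orthogonality to the differences of kernel sections
    at [act g x] and [x]. *)
Lemma hilbert_H_bar : hilbert_space (H_bar act H) ip.
Proof.
pose S := [set k ^~ (act p.1 p.2) \- k ^~ p.2 | p in [set: G * X]].
have Hkk := rkhs_kernel Hk.
have SH : S `<=` H by move=> _ [p _ <-]; exact: (hilbertB HH).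
have := hilbert_annihilator HH SH; congr hilbert_space.
apply/seteqP; split => f [Hf fP]; split => //.
  move=> g x; apply/subr0_eq; rewrite !(rkhs_reproducing Hk _ Hf) -(ipBr HH) //.
  by apply: fP; exists (g, x).
move=> _ [[g x] _ <-] /=.
by rewrite (ipBr HH) // -!(rkhs_reproducing Hk _ Hf) fP subrr.
Qed.

Lemma hilbert_H_perp : hilbert_space (H_perp lambda act H) ip.
Proof.
have SH : range kbar `<=` H by move=> _ [x _ <-]; exact: (orbit_avgE x).1.
have := hilbert_annihilator HH SH; congr hilbert_space.
apply/seteqP; split => f [Hf fP]; split => //.
  by apply/funext => x; rewrite (orbit_avgE x).2 //; apply: fP; exists x.
by move=> _ [x _ <-]; rewrite -(orbit_avgE x).2 // fP.
Qed.

Lemma rkhs_H_bar : is_rkhs (H_bar act H) ip kbar.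
Proof.
split; first exact: hilbert_H_bar.
  by move=> x; rewrite kbarl.
move=> f x [Hf f_inv].
by rewrite kbarl -(orbit_avgE x).2 // orbit_avg_invariant.
Qed.

(** On functions of zero average, subtracting [kbar x] from the kernel section leaves the reproduced
    value unchanged. *)
Lemma rkhs_H_perp :
  is_rkhs (H_perp lambda act H) ip (kernel_perp lambda act k).
Proof.
have perpE x : kernel_perp lambda act k ^~ x = k ^~ x \- kbar x.
  by apply/funext => y; rewrite /kernel_perp /= kernel_bar_sym.
have Hkk := rkhs_kernel Hk.
have Hkb x := (orbit_avgE x).1.
split; first exact: hilbert_H_perp.
- move=> x; rewrite perpE; split; first exact: (hilbertB HH).
  apply/funext => y; rewrite (orbit_avgE y).2; last exact: (hilbertB HH).
  (* At [y], the averages of [k ^~ x] and of the invariant [kbar x] are both [kbar y x]. *)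
  rewrite (ipBl HH) // -!(orbit_avgE y).2 // (orbit_avg_invariant (kbar_inv x)).
  rewrite kernel_bar_sym /orbit_avg /kernel_bar.
  by have [_ _ ->] := k_averages_agree y x; rewrite subrr.
- move=> f x [Hf f0]; rewrite perpE (ipBr HH) // -(orbit_avgE x).2 // f0 subr0.
  exact: (rkhs_reproducing Hk).
Qed.

Lemma H_bar_H_perp_decomposition :
  orthogonal_decomposition H ip (H_bar act H) (H_perp lambda act H).
Proof.
have proj := hilbert_projection HH Hbar_sub hilbert_H_bar.
(* The projection is the orbit average: [avg f x] and [p x] are the pairings of [f] and [p] with
   [kbar x], which is orthogonal to [f \- p]. *)
have orthE f p : H f -> H_bar act H p ->
    (forall a, H_bar act H a -> ip (f \- p) a = 0) -> avg f = p.
  move=> Hf [Hp p_inv] fp; apply/funext => x; rewrite (orbit_avgE x).2 //.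
  have -> : p x = ip p (kbar x).
    by rewrite -(orbit_avgE x).2 // orbit_avg_invariant.
  apply/subr0_eq.
  by rewrite -(ipBl HH) //; [exact: fp|exact: (orbit_avgE x).1].
split.
- apply/seteqP; split => [f Hf|_ [f [Hf _] [g [Hg _] <-]]]; last exact: (hilbertD HH).
  have [p pb fp] := proj f Hf; have [Hp p_inv] := pb.
  have Hfp : H (f \- p) by exact: (hilbertB HH).
  exists p => //; exists (f \- p); last first.
    by apply/funext => x /=; rewrite addrC subrK.
  by split => //; apply/funext => x; rewrite (orbit_avgE x).2 // fp.
- apply/seteqP; split => [f [[Hf f_inv] [_ f0]]|_ ->].
    by rewrite /= -f0 orbit_avg_invariant.
  by split; [exact: (hilbert0 hilbert_H_bar)|exact: (hilbert0 hilbert_H_perp)].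
(* The projection [p] of [g] is [avg g], hence zero, so [g] itself is the residual orthogonal to
   [f]. *)
- move=> f g fb [Hg g0]; have [p pb gp] := proj g Hg.
  have Hf := Hbar_sub fb.
  rewrite (ip_sym HH) // -(gp f fb); congr ip; apply/funext => x /=.
  by rewrite -(orthE _ _ Hg pb gp) g0 subr0.
Qed.

End bounded.
End orbit_averaging.

Theorem lemma3 (R : realType)
  (G : topologicalGroupType) (lambda : probability (borel G) R)
  (X : ptopologicalType) (mu : probability (borel X) R) (act : G -> X -> X)
  (k : X -> X -> R) (H : set (X -> R)) (ip : (X -> R) -> (X -> R) -> R)
  (G_compact : compact [set: G])
  (G_second_countable : @second_countable G)
  (G_hausdorff : hausdorff_space G)
  (lambda_haar : is_haar lambda)
  (X_polish : polish R X)
  (act_action : is_action act)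
  (act_measurable : null_measurable_fun (lambda \x mu)%E
     (fun p : borel G * borel X => act p.1 p.2 : borel X))
  (mu_support : measure_support mu = [set: X])
  (mu_invariant : invariant_measure act mu)
  (k_symmetric : forall x y, k x y = k y x)
  (k_positive_definite : positive_definite k)
  (k_measurable : measurable_fun [set: borel X * borel X]
     (fun p : borel X * borel X => k p.1 p.2))
  (k_continuous : forall x, continuous (fun z : X => k z x))
  (k_bounded : (ereal_sup (range (fun x => (k x x)%:E)) < +oo)%E)
  (k_averages_agree : averages_agree lambda act k)
  (H_rkhs : is_rkhs H ip k) :
  [/\ orthogonal_decomposition H ip (H_bar act H) (H_perp lambda act H),
      is_rkhs (H_bar act H) ip (kernel_bar lambda act k),
      is_rkhs (H_perp lambda act H) ip (kernel_perp lambda act k),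
      forall y, G_invariant act (fun x => kernel_bar lambda act k x y)
    & forall x, G_invariant act (fun y => kernel_bar lambda act k x y)].
Proof.
have [M k_le] : exists M, forall x, k x x <= M.
  have k_sup x : ((k x x)%:E <= ereal_sup (range (fun x => (k x x)%:E)))%E.
    by apply: ereal_sup_ubound; exists x.
  (* A finite supremum is the bound; [k_bounded] excludes [+oo], and the value of [k] at [point]
     excludes [-oo]. *)
  case: ereal_sup k_bounded k_sup => [M _|//|_ /(_ point)] H1; last by [].
  by exists M => x; rewrite -lee_fin.
have kbar_inv x : G_invariant act (kernel_bar lambda act k x).
  move=> h y; have [_ nk _] := k_averages_agree x y.
  (* Replacing [y] by [act h y] translates the integrand on the right by [h]. *)
  rewrite /kernel_bar -[RHS](Rintegral_mulgr G_second_countable lambda_haar h nk).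
  by apply: eq_Rintegral => g _; rewrite act_action.2.
split.
- exact: H_bar_H_perp_decomposition k_le kbar_inv.
- exact: rkhs_H_bar k_le kbar_inv.
- exact: rkhs_H_perp k_le kbar_inv.
- move=> y h x; rewrite !(kernel_bar_sym k_symmetric k_averages_agree _ y).
  exact: kbar_inv.
- exact: kbar_inv.
Qed.
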